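(* There exists a system that satisfies the standard CRDT conditions (the state space is a join-semilattice, the merge function is associative, commutative and idempotent, and communication is fair), in which the state value is guaranteed to converge, and which nevertheless admits two valid executions producing non-isomorphic causal histories.
   Context: A system consists of a finite set of agents (replicas) that create contributions and exchange them over an asynchronous network. A contribution is a tuple $(\mathrm{rid},\mathrm{parents},\mathrm{payload},k)$, where $\mathrm{rid}$ is a unique identifier, $\mathrm{parents}$ is a finite set of rids of contributions already observed by the creator at creation time (the direct causal predecessors), $\mathrm{payload}$ is an element of the state space $L_k$, and $k$ is a key. Each agent holds a local state in $L_k$ and, upon receiving a contribution, replaces its state by the merge (join) of its state with the payload. Communication is fair if every contribution is eventually delivered at least once to every agent subscribing to its key. The state value converges if, once all contributions have been delivered, all agents hold the same state value regardless of delivery order and duplication. The causal history of an execution is the directed graph whose vertices are the rids of the contributions generated and whose edges are $p\to r$ for $p\in\mathrm{parents}(r)$; histories are compared up to graph isomorphism. *)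

(* Defs.v *)
From mathcomp Require Import all_boot all_order finmap.
From mathcomp Require Import classical_sets functions.

Set Implicit Arguments.
Unset Strict Implicit.
Unset Printing Implicit Defensive.

Local Open Scope classical_set_scope.

(* [f] is total only for convenience: as [G] and [H] live over the same [T],
   every bijection between their vertex sets extends to a map [T -> T]. *)
Record digraph (T : Type) : Type := Digraph {
  vertices : set T;
  edge : T -> T -> Prop
}.

Definition digraph_iso (T : Type) (G H : digraph T) : Prop :=
  exists f : T -> T,
    set_bij (vertices G) (vertices H) f /\
    (forall x y, vertices G x -> vertices G y ->
       (edge G x y <-> edge H (f x) (f y))).

Section Events.
Variables (agent : Type) (rid : choiceType) (key : Type) (space : key -> Type).

Record contribution : Type := Contribution {
  crid : rid;
  parents : {fset rid};
  ckey : key;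
  payload : space ckey
}.

Inductive event : Type :=
| Create of agent & contribution
| Deliver of agent & contribution.

(* A finite or infinite run: one event, or nothing ([None]), per time step. *)
Definition execution_of : Type := nat -> option event.

End Events.

(* [merge] is data, related to the join of [space k] only by [crdt_conditions].
   [admits] is the communication layer: the executions it lets happen. *)
Record system : Type := System {
  agent : finType;
  rid : choiceType;
  key : eqType;
  space_disp : key -> Order.disp_t;
  space : forall k : key, joinSemilatticeType (space_disp k);
  merge : forall k : key, space k -> space k -> space k;
  init : forall k : key, space k;
  subscribes : agent -> key -> bool;
  admits : execution_of agent rid (fun k : key => space k) -> Prop
}.

Section Executions.
Variable S : system.

Definition contrib : Type := contribution (rid S) (fun k : key S => space k).
Definition execution : Type :=
  execution_of (agent S) (rid S) (fun k : key S => space k).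

Implicit Types (e : execution) (a b : agent S) (c : contrib) (k : key S).

Definition created e c : Prop := exists n a, e n = Some (Create a c).

Definition observed_before e a n c : Prop :=
  exists2 m, m < n & e m = Some (Create a c) \/ e m = Some (Deliver a c).

Definition delivered_before e a n c : Prop :=
  exists2 m, m < n & e m = Some (Deliver a c).

Definition unique_rids e : Prop :=
  forall m n a b c c', e m = Some (Create a c) -> e n = Some (Create b c') ->
    crid c = crid c' -> m = n.

Definition deliveries_created e : Prop :=
  forall n a c, e n = Some (Deliver a c) ->
    exists2 m, m < n & exists b, e m = Some (Create b c).

Definition parents_observed e : Prop :=
  forall n a c, e n = Some (Create a c) ->
    forall p, p \in parents c ->
      exists2 c', crid c' = p & observed_before e a n c'.

Definition well_formed e : Prop :=
  [/\ unique_rids e, deliveries_created e & parents_observed e].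

Definition valid_execution e : Prop := well_formed e /\ admits e.

(* [untag s F u] is [F] applied to the second component of [u] if the key
   stored in [u] is [k], and [s] otherwise. *)
Definition receive k (s : space k) c : space k :=
  untag s (fun x : space k => merge s x)
    (Tagged (fun k' : key S => space k') (payload c)).

(* [Create] leaves the states unchanged: the creator merges its own contribution
   when that is delivered to it, like any other agent. *)
Fixpoint state e a k (n : nat) : space k :=
  match n with
  | 0 => init k
  | m.+1 =>
      match e m with
      | Some (Deliver b c) =>
          if b == a then receive (state e a k m) c else state e a k m
      | _ => state e a k m
      end
  end.

Definition fair e : Prop :=
  forall c, created e c -> forall a, subscribes a (ckey c) ->
    exists n, e n = Some (Deliver a c).

Definition causal_history e : digraph (rid S) :=
  Digraph [set r | exists2 c, created e c & crid c = r]
    (fun p r => exists c, [/\ created e c, crid c = r & p \in parents c]).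

Definition all_delivered e k n : Prop :=
  forall c, created e c -> ckey c = k ->
    forall a, subscribes a k -> delivered_before e a n c.

Definition same_contributions e1 e2 k : Prop :=
  forall c, ckey c = k -> (created e1 c <-> created e2 c).

End Executions.

(* Arbitrary delays, reorderings and duplications happen: apart from fairness,
   the network excludes nothing. *)
Definition asynchronous (S : system) : Prop :=
  forall e : execution S, well_formed e -> fair e -> admits e.

(* That each state space is a join-semilattice is part of its type. *)
Definition crdt_conditions (S : system) : Prop :=
  [/\ forall (k : key S) (x y : space k), merge x y = Order.join x y,
      forall k : key S, associative (@merge S k),
      forall k : key S, commutative (@merge S k),
      forall k : key S, idempotent_op (@merge S k) &
      forall e : execution S, valid_execution e -> fair e].

(* Independence of delivery order and duplication is expressed by comparing
   two executions that generate the same contributions; [e1 = e2] gives the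
   agreement of the agents within one execution. *)
Definition state_converges (S : system) : Prop :=
  forall e1 e2 : execution S, valid_execution e1 -> valid_execution e2 ->
  forall k : key S, same_contributions e1 e2 k ->
  forall n1 n2 : nat, all_delivered e1 k n1 -> all_delivered e2 k n2 ->
  forall a1 a2 : agent S, subscribes a1 k -> subscribes a2 k ->
    state e1 a1 k n1 = state e2 a2 k n2.

(* Main.v *)
From mathcomp Require Import all_boot all_order finmap.
Require Import Defs.

Set Implicit Arguments.
Unset Strict Implicit.
Unset Printing Implicit Defensive.

Import Order.TTheory.

(** Convergence holds for every system whose merge is the join: once everything
    is delivered, the state at key [k] is the least upper bound of the initial
    state and all payloads created at [k], which depends neither on the agent
    nor on the order. This ignores [parents] altogether. So let one agent
    create a second contribution after having received a first one: whether it
    lists the first as a parent or not, the run is valid, but in one case the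
    history has an edge and in the other it has none. *)

Section Convergence.
Variable S : system.
Hypothesis merge_join :
  forall (k : key S) (x y : space k), merge x y = Order.join x y.

(** Spelling out the constructor puts the payload in [space k] itself, with no transport along an
    equality of keys. *)
Lemma receive_same_key (k : key S) (s p : space k) r ps :
  receive s (Contribution (space := fun k => space k) r ps p) = Order.join s p.
Proof. by rewrite /receive untagE merge_join. Qed.

Lemma receive_other_key (k : key S) (s : space k) (c : contrib S) :
  ckey c != k -> receive s c = s.
Proof. by move=> neq_k; rewrite /receive untag_dflt. Qed.

(** A least upper bound described by its upper bounds: no iterated join is formed, and two states
    can be compared by antisymmetry. *)
Lemma state_leP (e : execution S) a (k : key S) n (x : space k) :
  (state e a k n <= x)%O <->
  (init k <= x)%O /\
  forall m r ps (p : space k), m < n ->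
    e m = Some (Deliver a (Contribution (space := fun k => space k) r ps p)) ->
    (p <= x)%O.
Proof.
elim: n => [|n IHn] /=; first by split=> [le_x | []].
pose D m := forall r ps (p : space k),
  e m = Some (Deliver a (Contribution (space := fun k => space k) r ps p)) ->
  (p <= x)%O.
suff step : (match e n with
             | Some (Deliver b c) =>
                 if b == a then receive (state e a k n) c else state e a k n
             | _ => state e a k n
             end <= x)%O <-> (state e a k n <= x)%O /\ D n.
  rewrite step IHn; split=> [[[le_i le_n] Dn] | [le_i le_n]].
    split=> // m r ps p; rewrite ltnS leq_eqVlt => /predU1P[-> | lt_mn].
      exact: Dn.
    exact: le_n.
  split; last by move=> r ps p; apply: le_n.
  by split=> // m r ps p lt_mn; apply: le_n; apply: ltnW.
rewrite {}/D; case: (e n) => [[b c | b c] |]; try by split=> [|[]].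
case: eqVneq => [-> | neq_ba]; last first.
  by split=> [le_x | []//]; split=> // r ps p [eq_ba]; rewrite eq_ba eqxx in neq_ba.
case: (eqVneq (ckey c) k) => [|neq_k]; last first.
  rewrite receive_other_key //; split=> [le_x | []//]; split=> // r ps p [eq_c].
  by rewrite eq_c eqxx in neq_k.
case: c => r ps k' p /= eq_k; case: k / eq_k x IHn => x _.
rewrite receive_same_key leUx; split=> [/andP[-> le_p] | [-> le_p]].
  (* Injectivity only equates dependent pairs of key and payload; decidable equality of keys then
     gives equality of the payloads. *)
  split=> // r' ps' p' [_ _ /eqP]; rewrite -tag_eqE /tag_eq eqxx /=.
  by rewrite tagged_asE => /eqP <-.
exact: le_p (erefl _).
Qed.

(** A payload merged in [e1] was created there, hence also in [e2], where it has reached [a2] before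
    [n2]. *)
Lemma state_le (e1 e2 : execution S) (k : key S) n1 n2 a1 a2 :
    deliveries_created e1 -> same_contributions e1 e2 k ->
    all_delivered e2 k n2 -> subscribes a2 k ->
  (state e1 a1 k n1 <= state e2 a2 k n2)%O.
Proof.
move=> created1 same12 delivered2 sub2.
have [/(_ (lexx _))[le_init le_payload] _] :=
  state_leP e2 a2 n2 (state e2 a2 k n2).
apply/state_leP; split=> // m r ps p _ /created1[l _ [b e1l]].
set c := Contribution _ _ _ in e1l.
have c2 : created e2 c by apply/same12 => //; exists l, b.
by have [m' lt_m'] := delivered2 c c2 (erefl k) a2 sub2; apply: le_payload.
Qed.

Lemma merge_join_converges : state_converges S.
Proof.
move=> e1 e2 [[_ dc1 _] _] [[_ dc2 _] _] k same12 n1 n2 all1 all2 a1 a2 sub1 sub2.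
have same21 : same_contributions e2 e1 k.
  by move=> c eq_k; split=> /(same12 c eq_k).
by apply: le_anti; rewrite !state_le.
Qed.

End Convergence.

(** On [nat] the join is the maximum. The last field is [fair] unfolded, since [fair] takes the
    finished system as argument. *)
Definition max_register : system :=
  @System bool nat unit (fun=> _) (fun=> nat) (fun _ x y => Order.join x y)
    (fun=> 0) (fun _ _ => true)
    (fun e => forall c, (exists n a, e n = Some (Create a c)) ->
       forall a : bool, true -> exists n, e n = Some (Deliver a c)).

Definition write (r : nat) (ps : {fset nat}) (x : nat) : contrib max_register :=
  Contribution (key := unit) (space := fun=> nat) (ckey := tt) r ps x.

Definition two_writes (ps : {fset nat}) : execution max_register :=
  fun n => nth None
    [:: Some (Create false (write 0 fset0 1));
        Some (Deliver false (write 0 fset0 1));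
        Some (Deliver true (write 0 fset0 1));
        Some (Create true (write 1 ps 2));
        Some (Deliver false (write 1 ps 2));
        Some (Deliver true (write 1 ps 2))] n.

Lemma two_writes_created ps c :
  created (two_writes ps) c <-> c = write 0 fset0 1 \/ c = write 1 ps 2.
Proof.
split=> [[n [a]] | [] ->]; [| by exists 0, false | by exists 3, true].
case: n => [|[|[|[|[|[|n]]]]]] //; last by rewrite /two_writes /= nth_nil.
  by case=> _ <-; left.
by case=> _ <-; right.
Qed.

(** [parents_observed] bounds the parents only from above, so both subsets of the observed rids are
    allowed. *)
Lemma two_writes_valid ps :
  (ps `<=` [fset 0])%fset -> valid_execution (two_writes ps).
Proof.
move=> /fsubsetP sub_ps; split; last first.
  (* The witnesses are the delivery times, for agent [true] first. *)
  move=> c /two_writes_created[] -> [] _.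
  - by exists 2.
  - by exists 1.
  - by exists 5.
  - by exists 4.
split.
- move=> m n a b c c'.
  case: m => [|[|[|[|[|[|m]]]]]] //; last by rewrite /two_writes /= nth_nil.
    case: n => [|[|[|[|[|[|n]]]]]] //; last by rewrite /two_writes /= nth_nil.
    by case=> _ <- [_ <-].
  case: n => [|[|[|[|[|[|n]]]]]] //; last by rewrite /two_writes /= nth_nil.
  by case=> _ <- [_ <-].
- move=> n a c.
  case: n => [|[|[|[|[|[|n]]]]]] //; last by rewrite /two_writes /= nth_nil.
  + by case=> _ <-; exists 0 => //; exists false.
  + by case=> _ <-; exists 0 => //; exists false.
  + by case=> _ <-; exists 3 => //; exists true.
  + by case=> _ <-; exists 3 => //; exists true.
- move=> n a c.
  case: n => [|[|[|[|[|[|n]]]]]] //; last by rewrite /two_writes /= nth_nil.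
    by case=> _ <- p; rewrite in_fset0.
  case=> <- <- p /sub_ps /fset1P ->.
  (* Write 0 reaches agent [true] at time 2, just before the creation at time 3. *)
  by exists (write 0 fset0 1) => //; exists 2 => //; right.
Qed.

Theorem proposition2 :
  exists S : system,
    asynchronous S /\ crdt_conditions S /\ state_converges S /\
    exists e1 e2 : execution S,
      valid_execution e1 /\ valid_execution e2 /\
      ~ digraph_iso (causal_history e1) (causal_history e2).
Proof.
exists max_register; split; first by move=> e _ fair_e c created_c a; apply: fair_e.
split.
  split=> //.
  - by move=> k; apply: joinA.
  - by move=> k; apply: joinC.
  - by move=> k; apply: joinxx.
  - by move=> e [_ fair_e] c created_c a; apply: fair_e.
split; first exact: merge_join_converges.
exists (two_writes [fset 0]%fset), (two_writes fset0).
split; first exact: two_writes_valid.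
split; first by apply: two_writes_valid; apply: fsub0set.
case=> f [_ /(_ 0 1) iso].
have v0 : vertices (causal_history (two_writes [fset 0]%fset)) 0.
  by exists (write 0 fset0 1) => //; apply/two_writes_created; left.
have v1 : vertices (causal_history (two_writes [fset 0]%fset)) 1.
  by exists (write 1 [fset 0]%fset 2) => //; apply/two_writes_created; right.
(* The edge from 0 to 1 would map to an edge of the second history, where all parent sets are
   empty. *)
have [] := (iso v0 v1).1.
  exists (write 1 [fset 0]%fset 2).
  by split; rewrite ?fset11 //; apply/two_writes_created; right.
by move=> c [/two_writes_created[] -> _] /=; rewrite in_fset0.
Qed.
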